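(* Let $S$ be a closed symmetric operator in a Hilbert space $H$ with finite and equal defect indices, let $V\ge0$ be a bounded operator on $H$, let $A=S+\mathrm{i}V$ and let $\widehat A$ be a maximally dissipative extension of $A$. Let $\widehat S=S^*|_{\mathcal{D}(\widehat A)}$, let $\widetilde S=S^*|_{\mathcal{H}_{\mathrm{sym}}(\widehat S)}$ be its symmetric part, and let $W\subseteq\mathcal{H}_{\mathrm{sym}}(\widehat A)$ be a subspace such that $$\mathcal{H}_{\mathrm{sym}}(\widehat A)=\big(\mathcal{D}(\widetilde S)\cap\ker V\big)\dot+W,\qquad W\cap\mathcal{D}(\widetilde S)=W\cap\ker V=\{0\}.$$ Assume that $\widetilde Sh\in\ker V$ for all $h\in\mathcal{D}(\widetilde S)\cap\ker V$ and that $\widetilde S$ is completely non-selfadjoint. (i) If $W=\{0\}$, then $H_{sa}(\widehat A)=\{0\}$. (ii) If $\dim W=\mu$, then $\dim(H_{sa}(\widehat A))\le\mu$.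
   Context: Hilbert spaces are complex; inner products are linear in the second argument; symmetric operators are densely defined. A densely defined operator $T$ is dissipative if $\operatorname{Im}\langle x,Tx\rangle\ge0$ for all $x\in\mathcal{D}(T)$, and maximally dissipative if it has moreover no non-trivial dissipative extension. It is known that every maximally dissipative extension $\widehat A$ of $A=S+\mathrm{i}V$ ($\mathcal{D}(A)=\mathcal{D}(S)$) satisfies $\mathcal{D}(\widehat A)\subseteq\mathcal{D}(S^* )$ and that $\widehat S:=S^*|_{\mathcal{D}(\widehat A)}$ is a maximally dissipative extension of $S$. For a densely defined operator $T$, $\mathcal{H}_{\mathrm{sym}}(T):=\ker(T-T^* )=\{f\in\mathcal{D}(T)\cap\mathcal{D}(T^* ):Tf=T^*f\}$. The operator $\widetilde S$ with $\mathcal{D}(\widetilde S)=\mathcal{H}_{\mathrm{sym}}(\widehat S)$, $\widetilde Sf=S^*f$, is a closed symmetric operator with $S\subseteq\widetilde S\subseteq\widehat S$. A finite-dimensional subspace $W$ with the stated properties always exists. A closed subspace $\mathcal{M}$ reduces $T$ if $\mathcal{D}(T)=(\mathcal{D}(T)\cap\mathcal{M})\oplus(\mathcal{D}(T)\cap\mathcal{M}^\perp)$ and $T$ maps $\mathcal{D}(T)\cap\mathcal{M}$ into $\mathcal{M}$ and $\mathcal{D}(T)\cap\mathcal{M}^\perp$ into $\mathcal{M}^\perp$. It is a selfadjoint subspace of $T$ if it reduces $T$ and the restriction of $T$ to $\mathcal{M}\cap\mathcal{D}(T)$ is selfadjoint in $\mathcal{M}$. $T$ is completely non-selfadjoint if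 $\{0\}$ is its only selfadjoint subspace. $H_{sa}(T)$ denotes the largest selfadjoint subspace of $T$ (which exists for maximally dissipative and for closed symmetric operators). *)

(* Defs.v *)
From HB Require Import structures.
From mathcomp Require Import all_boot all_order all_algebra.
From mathcomp Require Import sesquilinear complex.
From mathcomp Require Import all_classical all_reals all_analysis.

Set Implicit Arguments.
Unset Strict Implicit.
Unset Printing Implicit Defensive.

Import Order.TTheory GRing.Theory Num.Theory.
Import numFieldNormedType.Exports.

Local Open Scope classical_set_scope.
Local Open Scope ring_scope.

(* [{dot H for Num.conj}] is a positive definite hermitian form, linear in its
   first argument. Norms are [R[i]]-valued, hence the equation in [R[i]]. *)
HB.mixin Record isHilbert (R : realType) H of CompleteNormedModule R[i] H := {
  dotp : {dot H for @Num.conj R[i]};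
  sqr_norm_dotp : forall x : H, `|x| ^+ 2 = dotp x x }.

#[short(type="hilbertType")]
HB.structure Definition Hilbert (R : realType) :=
  {H of isHilbert R H & CompleteNormedModule R[i] H}.

(* The inner product <x, y>, linear in [y]. *)
Definition inner (R : realType) (H : hilbertType R) (x y : H) : R[i] := dotp y x.

Section Subspaces.
Context {R : realType} {H : hilbertType R}.
Implicit Types M N L : set H.

Definition is_subspace M := submod_closed [in M].

Definition orthocomplement M : set H := [set x | forall y, M y -> inner y x = 0].

(* L = M \dot+ N *)
Definition is_direct_sum L M N :=
  L = [set x + y | x in M & y in N] /\ M `&` N = [set 0].

Definition has_dim M (n : nat) := exists e : 'I_n -> H,
  (forall c : 'I_n -> R[i], \sum_i c i *: e i = 0 -> forall i, c i = 0) /\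
  M = [set \sum_i c i *: e i | c in [set: 'I_n -> R[i]]].

End Subspaces.

(* An operator in H is identified with its graph, a subset of H * H: its domain
   is [T.`1], extensions are inclusions of graphs, equality is equality of
   graphs. *)
Section Operators.
Context {R : realType} {H : hilbertType R}.
Implicit Types (T B : set (H * H)) (M D : set H) (V : H -> H).

Definition is_operator T :=
  submod_closed [in T] /\ (forall x y z, T (x, y) -> T (x, z) -> y = z).

Definition densely_defined T := dense (T.`1).

Definition restriction T D : set (H * H) := [set p | T p /\ D p.1].

(* For T contained in [M `*` M], the adjoint of T as an operator in the Hilbert
   space M. It is the graph of an operator when the domain of T is dense in M. *)
Definition adjoint_in M T : set (H * H) :=
  [set p | [/\ M p.1, M p.2 & forall q, T q -> inner p.1 q.2 = inner p.2 q.1]].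

Definition adjoint T := adjoint_in [set: H] T.

Definition symmetric_op T := [/\ is_operator T, densely_defined T &
  forall p q, T p -> T q -> inner p.1 q.2 = inner p.2 q.1].

Definition dissipative T := [/\ is_operator T, densely_defined T &
  forall p, T p -> 0 <= 'Im (inner p.1 p.2)].

Definition maximally_dissipative T :=
  dissipative T /\ forall B, dissipative B -> T `<=` B -> B = T.

Definition defect_indices T (nplus nminus : nat) :=
  has_dim [set x | adjoint T (x, 'i *: x)] nplus /\
  has_dim [set x | adjoint T (x, - 'i *: x)] nminus.

Definition bounded_op V := exists C : R[i], forall x, `|V x| <= C * `|x|.

(* On [R[i]], [0 <= z] means that z is real and nonnegative. *)
Definition nonneg_op V := forall x, 0 <= inner x (V x).

Definition kernel_op V : set H := [set x | V x = 0].

(* S + iV, with the domain of S. *)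
Definition add_imag T V : set (H * H) :=
  [set (p.1, p.2 + 'i *: V p.1) | p in T].

(* H_sym(T) = ker (T - T^* ) *)
Definition Hsym T : set H := [set f | exists g, T (f, g) /\ adjoint T (f, g)].

Definition reduces M T :=
  [/\ is_subspace M, closed M,
      is_direct_sum T.`1 (T.`1 `&` M) (T.`1 `&` orthocomplement M),
      (forall x y, T (x, y) -> M x -> M y) &
      (forall x y, T (x, y) -> orthocomplement M x -> orthocomplement M y)].

Definition selfadjoint_in M T :=
  [/\ T.`1 `<=` M, M `<=` closure (T.`1) & T = adjoint_in M T].

Definition selfadjoint_subspace T M :=
  reduces M T /\ selfadjoint_in M (restriction T M).

Definition completely_nonselfadjoint T :=
  [set M | selfadjoint_subspace T M] = [set [set 0]].

Definition largest_selfadjoint_subspace T M :=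
  selfadjoint_subspace T M /\ forall N, selfadjoint_subspace T N -> N `<=` M.

(* The default value [set0] is not a subspace and has no dimension in the sense
   of [has_dim]. *)
Definition Hsa T : set H := xget set0 [set M | largest_selfadjoint_subspace T M].

(* The operators \hat S and \tilde S built from S and \hat A. *)
Definition hatS (S Ahat : set (H * H)) := restriction (adjoint S) Ahat.`1.

Definition tildeS (S Ahat : set (H * H)) :=
  restriction (adjoint S) (Hsym (hatS S Ahat)).

End Operators.

(* Main.v *)
(* Let M be a selfadjoint subspace of Ahat. Splitting along M shows that
   D(Ahat) /\ M lies in Hsym Ahat, whose vectors agree modulo ker V with vectors
   of W; hence V maps D(Ahat) /\ M onto a space of dimension at most dim W. A
   functional on D(Ahat) /\ M that vanishes on ker V therefore has the form
   f |-> <z, V f> = <V z, f>, and so is bounded. This bounded correction carries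
   the selfadjointness of Ahat on M over to N = M /\ ker V: N is the closure of
   D(Ahat) /\ N, and Ahat restricted to N is selfadjoint. On N the operators Ahat
   and \tilde S agree, so N is a selfadjoint subspace of \tilde S and N = {0}.
   Thus V is injective on M, dim M <= dim W, and M is contained in D(Ahat).
   Selfadjoint subspaces being finite-dimensional, the sum of two of them is
   again one, and one of maximal dimension is the largest. *)
Require Import Defs.
From mathcomp Require Import all_boot all_order all_algebra.
From mathcomp Require Import sesquilinear complex.
From mathcomp Require Import all_classical all_reals all_analysis.
From mathcomp Require Import ring lra.

Set Implicit Arguments.
Unset Strict Implicit.
Unset Printing Implicit Defensive.

Import Order.TTheory GRing.Theory Num.Theory.
Import numFieldNormedType.Exports.

Local Open Scope classical_set_scope.
Local Open Scope ring_scope.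

(** * Subspaces as sets *)

Section Submod.
Context {K : pzRingType} {U : lmodType K} {M : set U}.
Implicit Types (x y : U) (a : K).

Lemma submod_setP :
  submod_closed [in M] <->
  M 0 /\ forall a x y, M x -> M y -> M (a *: x + y).
Proof.
split=> -[M0 ML]; split.
- by have := M0; rewrite inE.
- move=> a x y Mx My; have := ML a x y; rewrite !inE; exact.
- by rewrite inE.
- by move=> a x y; rewrite !inE; exact: ML.
Qed.

Hypothesis subM : submod_closed [in M].

Lemma submod0 : M 0. Proof. by have /submod_setP[] := subM. Qed.

Lemma submodP a x y : M x -> M y -> M (a *: x + y).
Proof. by have /submod_setP[_] := subM; apply. Qed.

Lemma submodZ a x : M x -> M (a *: x).
Proof.
by move=> Mx; rewrite -[a *: x]addr0; apply: submodP => //; exact: submod0.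
Qed.

Lemma submodD x y : M x -> M y -> M (x + y).
Proof. by move=> Mx My; rewrite -[x]scale1r; exact: submodP. Qed.

Lemma submodB x y : M x -> M y -> M (x - y).
Proof. by move=> Mx My; rewrite addrC -scaleN1r; exact: submodP. Qed.

Lemma submod_sum n (f : 'I_n -> U) : (forall i, M (f i)) -> M (\sum_i f i).
Proof.
by move=> Mf; elim/big_ind : _ => //; [exact: submod0|exact: submodD].
Qed.

Lemma submod_lincomb n (c : 'I_n -> K) (f : 'I_n -> U) :
  (forall i, M (f i)) -> M (\sum_i c i *: f i).
Proof. by move=> Mf; apply: submod_sum => i; exact: submodZ. Qed.

End Submod.

Section SubmodOps.
Context {K : pzRingType} {U : lmodType K}.
Implicit Types M N : set U.

Lemma submodI M N : submod_closed [in M] -> submod_closed [in N] ->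
  submod_closed [in M `&` N].
Proof.
move=> sM sN; apply/submod_setP; split.
  by split; [exact: (submod0 sM)|exact: (submod0 sN)].
move=> a x y [Mx Nx] [My Ny].
by split; [exact: (submodP sM)|exact: (submodP sN)].
Qed.

Lemma submod_add M N : submod_closed [in M] -> submod_closed [in N] ->
  submod_closed [in [set x + y | x in M & y in N]].
Proof.
move=> sM sN; apply/submod_setP; split.
  by exists 0; [exact: submod0|exists 0; [exact: submod0|rewrite addr0]].
move=> a _ _ [x1 Mx1 [y1 Ny1 <-]] [x2 Mx2 [y2 Ny2 <-]].
exists (a *: x1 + x2); first exact: (submodP sM).
exists (a *: y1 + y2); first exact: (submodP sN).
by rewrite scalerDr addrACA.
Qed.

End SubmodOps.

(** * Inner products and closures *)

Section InnerProduct.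
Context {R : realType} {H : hilbertType R}.
Implicit Types (x y z : H) (a : R[i]) (M : set H).

Lemma innerC x y : inner x y = (inner y x)^*.
Proof. by rewrite /inner hermC expr0 mul1r. Qed.

Lemma innerDr x y z : inner x (y + z) = inner x y + inner x z.
Proof. exact: linearDl. Qed.

Lemma innerDl x y z : inner (x + y) z = inner x z + inner y z.
Proof. exact: linearDr. Qed.

Lemma innerBr x y z : inner x (y - z) = inner x y - inner x z.
Proof. exact: linearBl. Qed.

Lemma innerBl x y z : inner (x - y) z = inner x z - inner y z.
Proof. exact: linearBr. Qed.

Lemma innerZr a x y : inner x (a *: y) = a * inner x y.
Proof. exact: linearZl_LR. Qed.

Lemma innerZl a x y : inner (a *: x) y = a^* * inner x y.
Proof. exact: linearZr_LR. Qed.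

Lemma inner0r x : inner x 0 = 0.
Proof. exact: linear0l. Qed.

Lemma inner0l x : inner 0 x = 0.
Proof. exact: linear0r. Qed.

Lemma inner_sumr x n (f : 'I_n -> H) : inner x (\sum_i f i) = \sum_i inner x (f i).
Proof. exact: linear_sumlz. Qed.

Lemma inner_suml x n (f : 'I_n -> H) : inner (\sum_i f i) x = \sum_i inner (f i) x.
Proof. exact: linear_sumr. Qed.

Lemma inner_ge0 x : 0 <= inner x x.
Proof. exact: dnorm_ge0. Qed.

Lemma inner_eq0 x : inner x x = 0 -> x = 0.
Proof. by move=> /eqP; rewrite /inner dnorm_eq0 => /eqP. Qed.

Lemma inner_gt0 x : x != 0 -> 0 < inner x x.
Proof. by rewrite /inner dnorm_gt0. Qed.

Lemma inner_norm x : inner x x = `|x| ^+ 2.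
Proof. by rewrite sqr_norm_dotp. Qed.

Lemma inner_sym0 x y : inner x y = 0 -> inner y x = 0.
Proof. by move=> xy0; rewrite innerC xy0 conjC0. Qed.

Lemma inner_eq x y : (forall z, inner z x = inner z y) -> x = y.
Proof.
move=> xy; apply/eqP; rewrite -subr_eq0; apply/eqP/inner_eq0.
by rewrite innerBr xy subrr.
Qed.

(** Removing from x its component along y leaves a vector orthogonal to y. Nonnegativity of its
    square gives Cauchy-Schwarz, and the loss of norm forces distance minimizers to have orthogonal
    residuals. *)
Lemma inner_subproj x y : y != 0 ->
  let z := x - (inner y x / inner y y) *: y in
  inner z z = inner x x - `|inner y x| ^+ 2 / inner y y.
Proof.
move=> y0 z; have yy0 : inner y y != 0 by rewrite gt_eqF// inner_gt0.
have yz : inner y z = 0 by rewrite innerBr innerZr divfK// subrr.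
rewrite {1}/z innerBl innerZl yz mulr0 subr0 innerBr innerZr.
by rewrite [inner x y]innerC normCK mulrAC.
Qed.

Lemma norm_inner_le x y : `|inner y x| <= `|y| * `|x|.
Proof.
have [->|y0] := eqVneq y 0; first by rewrite inner0l !normr0 mul0r.
rewrite -(@ler_pXn2r _ 2%N)// ?nnegrE ?mulr_ge0// exprMn -!inner_norm.
rewrite mulrC -ler_pdivrMr ?inner_gt0// -subr_ge0.
by rewrite -inner_subproj// inner_ge0.
Qed.

Lemma closure_normP M x :
  closure M x <-> forall e : R[i], 0 < e -> exists2 y, M y & `|x - y| < e.
Proof.
split=> [clx e e0|Mx B].
  have [y [My]] := clx _ (nbhsx_ballx x e e0).
  by rewrite -ball_normE => ?; exists y.
move=> /nbhs_ballP[e /= e0 eB]; have [y My xy] := Mx _ e0.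
by exists y; split => //; apply: eB; rewrite -ball_normE.
Qed.

Lemma closure_ortho M y x :
  (forall z, M z -> inner y z = 0) -> closure M x -> inner y x = 0.
Proof.
move=> My clx; apply/eqP; apply: contraT => yx0.
have y1 : 0 < `|y| + 1 by rewrite ltr_wpDl.
(* With this radius Cauchy-Schwarz puts |<y, x - z>| strictly below |<y, x>|, although the two are
   equal. The [+ 1] keeps the denominator positive. *)
have e0 : 0 < `|inner y x| / (`|y| + 1) by rewrite divr_gt0// normr_gt0.
have [z Mz] := (closure_normP M x).1 clx _ e0; rewrite ltr_pdivlMr// => xz.
have := norm_inner_le (x - z) y; rewrite innerBr (My z)// subr0 => le_yx.
rewrite -(ltxx `|inner y x|).
apply: le_lt_trans le_yx _; apply: le_lt_trans xz.
by rewrite mulrC ler_wpM2l// ler_wpDr.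
Qed.

Lemma orthocomplement_closed M : closed (orthocomplement M).
Proof.
by move=> x clx y My; apply: (closure_ortho _ clx) => z; exact.
Qed.

Lemma orthocomplement_submod M : submod_closed [in orthocomplement M].
Proof.
apply/submod_setP; split=> [y _|a x y xM yM z Mz]; first by rewrite inner0r.
by rewrite innerDr innerZr xM// yM// mulr0 addr0.
Qed.

Lemma closure_submod M : submod_closed [in M] -> submod_closed [in closure M].
Proof.
move=> sM; apply/submod_setP; split; first exact/subset_closure/submod0.
move=> a x y /closure_normP clx /closure_normP cly; apply/closure_normP => e e0.
have a1 : 0 < `|a| + 1 by rewrite ltr_wpDl.
have e2 : 0 < e / 2 by rewrite divr_gt0.
have [x' Mx' xx'] := clx (e / 2 / (`|a| + 1)) (divr_gt0 e2 a1).
have [y' My' yy'] := cly (e / 2) e2.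
exists (a *: x' + y'); first exact: submodP.
rewrite opprD addrACA -scalerBr (splitr e); apply: le_lt_trans (ler_normD _ _) _.
apply: ler_ltD yy'; rewrite normrZ; move: xx'; rewrite ltr_pdivlMr// => /ltW.
by apply: le_trans; rewrite mulrC ler_wpM2l// ler_wpDr.
Qed.

End InnerProduct.

(** * Orthogonal projection *)

Section Projection.
Context {R : realType} {H : hilbertType R}.
Implicit Types (x y z p m : H) (M : set H).
Local Open Scope complex_scope.

(** The norm has values in [R[i]]; its real part gives access to [inf] and to real arithmetic in
    [R]. *)
Let nrm x : R := complex.Re `|x|.

Let nrmE x : `|x| = (nrm x)%:C.
Proof. by rewrite /nrm RRe_real// ger0_real. Qed.

Let nrm_ge0 x : 0 <= nrm x.
Proof. by rewrite -lecR -nrmE normr_ge0. Qed.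

Let nrmD x y : nrm (x + y) <= nrm x + nrm y.
Proof. by rewrite -lecR raddfD /= -!nrmE ler_normD. Qed.

Let innerE x : inner x x = (nrm x ^+ 2)%:C.
Proof. by rewrite inner_norm nrmE -rmorphXn. Qed.

(** Solved for the distance with the midpoint isolated: midpoints stay in a subspace, so the infimum
    of distances bounds the last term from below. *)
Let parallelogram x y :
  nrm (x - y) ^+ 2 = 2 * nrm x ^+ 2 + 2 * nrm y ^+ 2 - 4 * nrm (2^-1 *: (x + y)) ^+ 2.
Proof.
have C2 : nrm (2^-1 *: (x + y)) = 2^-1 * nrm (x + y).
  rewrite /nrm normrZ normfV normr_nat nrmE.
  by rewrite -(rmorph_nat (real_complex R)) -fmorphV -rmorphM.
have E : nrm (x - y) ^+ 2 + nrm (x + y) ^+ 2 = 2 * nrm x ^+ 2 + 2 * nrm y ^+ 2.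
  apply: (fmorph_inj (real_complex R)); rewrite !raddfD /= !(rmorphM _ (2 : R)) /=.
  rewrite -!innerE !(innerBl, innerBr, innerDl, innerDr) rmorph_nat.
  ring.
by rewrite C2 exprMn -E; field.
Qed.

(** The projection is the limit of points of M that nearly minimize the distance to x. The
    parallelogram law makes them Cauchy, and a minimizer has a residual orthogonal to M. *)
Lemma ortho_projection M x : submod_closed [in M] -> closed M ->
  exists2 p, M p & orthocomplement M (x - p).
Proof.
move=> sM cM; pose E := [set nrm (x - m) ^+ 2 | m in M]; pose d := inf E.
have infE : has_inf E.
  split; first by exists (nrm (x - 0) ^+ 2); exists 0 => //; exact: submod0.
  by exists 0 => _ [m _ <-]; rewrite sqr_ge0.
have d_le m : M m -> d <= nrm (x - m) ^+ 2.
  by move=> Mm; apply: ge_inf; [exact: infE.2|exists m].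
pose A (e : R) := [set m | M m /\ nrm (x - m) ^+ 2 < d + e].
pose F := filter_from [set e : R | 0 < e] A.
have FF : ProperFilter F.
  apply: filter_from_proper; last first.
    move=> e e0; have [_ [m Mm <-] lte] := inf_adherent e0 infE.
    by exists m.
  apply: filter_from_filter; first by exists 1; rewrite /= ltr01.
  move=> i j i0 j0; exists (Num.min i j); first by rewrite /= lt_min i0.
  move=> m [Mm lem]; split; split=> //; apply: lt_le_trans lem _;
    by rewrite lerD2l ge_min lexx ?orbT.
have A_close e m m' : A e m -> A e m' -> nrm (m - m') ^+ 2 < 4 * e.
  move=> [Mm le_m] [Mm' le_m'].
  have -> : m - m' = (x - m') - (x - m).
    by rewrite opprB [RHS]addrC addrA subrK.
  rewrite parallelogram.
  have -> : 2^-1 *: (x - m' + (x - m)) = x - 2^-1 *: (m' + m).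
    rewrite addrACA -opprD scalerBr -mulr2n -[x *+ 2]scaler_nat.
    by rewrite scalerA mulVf ?scale1r.
  have := d_le _ (submodZ sM 2^-1 (submodD sM Mm' Mm)).
  by move: le_m le_m'; lra.
have Fcauchy : cauchy F.
  apply: cauchy_exP => e e0.
  have eR : e = (complex.Re e)%:C by rewrite RRe_real// gtr0_real.
  have r0 : 0 < complex.Re e by rewrite -ltcR -eR.
  (* [A_close] loses a factor 4 on squared distances, which this choice absorbs. *)
  have de0 : 0 < (complex.Re e) ^+ 2 / 4 by rewrite divr_gt0// exprn_gt0.
  have [_ [m Mm <-] ltm] := inf_adherent de0 infE.
  exists m; exists ((complex.Re e) ^+ 2 / 4) => // m' Am'.
  rewrite -ball_normE /= nrmE eR ltcR.
  rewrite -(@ltr_pXn2r _ 2%N)// ?nnegrE// ?(ltW r0)//.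
  apply: lt_le_trans (A_close _ _ _ (conj Mm ltm) Am') _.
  by rewrite mulrC divfK.
have [p Fp] : exists p, F --> p by exists (lim F); exact: cauchy_cvg.
have Mp : M p.
  apply: (@closed_cvg _ _ F _ id M cM _ p Fp).
  by exists 1 => //= m [].
have p_min m : M m -> nrm (x - p) <= nrm (x - m).
  move=> Mm; rewrite leNgt; apply/negP => lt_mp.
  (* A point m' of M within (b - a) / 2 of p and at distance below (a + b) / 2 from x gives b < b by
     the triangle inequality. *)
  set a := nrm (x - m) in lt_mp; set b := nrm (x - p) in lt_mp.
  have e0 : (0 : R[i]) < ((b - a) / 2)%:C by rewrite ltcR divr_gt0// subr_gt0.
  have B : F (ball p ((b - a) / 2)%:C) by apply: Fp; exact: nbhsx_ballx.
  have a0 : 0 <= a by exact: nrm_ge0.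
  have de0 : 0 < ((a + b) / 2) ^+ 2 - a ^+ 2 by nra.
  have FA : F (A (((a + b) / 2) ^+ 2 - a ^+ 2)) by exists (((a + b) / 2) ^+ 2 - a ^+ 2).
  have [m' [Bm' [Mm' ltm']]] := filter_ex (filterI B FA).
  move: Bm'; rewrite -ball_normE /= nrmE ltcR => pm'.
  have lt1 : nrm (x - m') < (a + b) / 2.
    rewrite -(@ltr_pXn2r _ 2%N)// ?nnegrE//; last by lra.
    by apply: lt_le_trans ltm' _; have := d_le _ Mm; rewrite -/a; lra.
  have := nrmD (x - m') (m' - p).
  rewrite addrA subrK -/b => b_le.
  have : nrm (m' - p) = nrm (p - m') by rewrite /nrm distrC.
  by lra.
exists p => // y My; apply/eqP; apply: contraT => yp0.
have y0 : y != 0 by apply: contraNneq yp0 => ->; rewrite inner0l.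
(* If y were not orthogonal to x - p, adding to p the component of x - p along y would move it
   inside M strictly closer to x. *)
have := inner_subproj (x - p) y0.
set c := inner y (x - p) / inner y y => E1.
have : inner (x - p) (x - p) <= inner (x - p - c *: y) (x - p - c *: y).
  rewrite !innerE lecR ler_pXn2r ?nnegrE//.
  rewrite -addrA -opprD; apply: p_min; apply: submodD => //; exact: submodZ.
rewrite /= in E1; rewrite E1 lerBrDl gerDr.
by rewrite pmulr_lle0 ?invr_gt0 ?inner_gt0// real_leNgt ?exprn_gt0 ?normr_gt0.
Qed.

(** The hypothesis is tested on the residual of x after projection onto the closure of M: orthogonal
    to M, it is orthogonal to x, hence to itself. *)
Lemma closure_biortho M x : submod_closed [in M] ->
  (forall y, (forall z, M z -> inner y z = 0) -> inner y x = 0) -> closure M x.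
Proof.
move=> sM Mx.
have [p Mp xp] := ortho_projection x (closure_submod sM) (@closed_closure _ M).
have xp0 y : closure M y -> inner (x - p) y = 0 by move=> /xp/inner_sym0.
have /Mx xpx : forall z, M z -> inner (x - p) z = 0.
  by move=> z Mz; apply/xp0/subset_closure.
suff /inner_eq0/eqP : inner (x - p) (x - p) = 0 by rewrite subr_eq0 => /eqP->.
by rewrite innerBr xpx xp0// subrr.
Qed.

End Projection.

(** * Finite-dimensional subspaces *)

Section FiniteDimension.
Context {R : realType} {H : hilbertType R}.
Implicit Types (x y z : H) (M N : set H).

Definition lin_indep n (e : 'I_n -> H) :=
  forall c : 'I_n -> R[i], \sum_i c i *: e i = 0 -> forall i, c i = 0.

Definition lin_span n (e : 'I_n -> H) : set H :=
  [set \sum_i c i *: e i | c in [set: 'I_n -> R[i]]].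

Lemma lin_span_submod n (e : 'I_n -> H) : submod_closed [in lin_span e].
Proof.
apply/submod_setP; split.
  by exists (fun=> 0) => //; rewrite big1// => i _; rewrite scale0r.
move=> a _ _ [c _ <-] [c' _ <-]; exists (fun i => a * c i + c' i) => //.
rewrite scaler_sumr -big_split; apply: eq_bigr => i _.
by rewrite scalerDl scalerA.
Qed.

Lemma lin_span_gen n (e : 'I_n -> H) i : lin_span e (e i).
Proof.
exists (fun j => (j == i)%:R) => //; rewrite (bigD1 i)//= eqxx scale1r.
by rewrite big1 ?addr0// => j /negPf->; rewrite scale0r.
Qed.

(** The coefficient matrix of f over e has trivial left kernel, so its rank m is at most its number
    n of columns. *)
Lemma lin_indep_leq m n (f : 'I_m -> H) (e : 'I_n -> H) :
  lin_indep f -> (forall j, lin_span e (f j)) -> (m <= n)%N.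
Proof.
move=> indf /(_ _)/cid2 fe.
pose C := \matrix_(j, i) s2val (fe j) i : 'M[R[i]]_(m, n).
have fE j : f j = \sum_i C j i *: e i.
  by rewrite -(s2valP' (fe j)); apply: eq_bigr => i _; rewrite mxE.
suff /eqP<- : row_free C by exact: rank_leq_col.
rewrite -kermx_eq0; apply/rowV0P => u /sub_kermxP uC0.
apply/rowP => j; rewrite mxE; apply: (indf (fun j => u 0 j)).
under eq_bigr do rewrite fE scaler_sumr.
rewrite exchange_big big1//= => i _.
have := congr1 (fun w : 'rV__ => w 0 i) uC0; rewrite !mxE => Ei.
under eq_bigr do rewrite scalerA.
by rewrite -scaler_suml Ei scale0r.
Qed.

Lemma lin_indep_cons n (f : 'I_n -> H) x :
  lin_indep f -> ~ lin_span f x ->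
  lin_indep (fun i : 'I_n.+1 => oapp f x (unlift ord0 i)).
Proof.
move=> indf xf c; rewrite big_ord_recl unlift_none /=.
under eq_bigr do rewrite liftK /=.
have [c0|c0] := eqVneq (c ord0) 0.
  rewrite c0 scale0r add0r => /indf c0' i.
  by case: (unliftP ord0 i) => [j ->|->].
move=> /eqP; rewrite addr_eq0 => /eqP cx; exfalso; apply: xf.
rewrite -[x]scale1r -(mulVf c0) -scalerA cx -scaleN1r.
do 2 apply: (submodZ (lin_span_submod f)).
by apply: (submod_lincomb (lin_span_submod f)) => i; exact: lin_span_gen.
Qed.

Lemma has_dim_submod M n : has_dim M n -> submod_closed [in M].
Proof. by move=> [e [_ ->]]; exact: lin_span_submod. Qed.

Lemma has_dim_indep_leq M n m (f : 'I_m -> H) :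
  has_dim M n -> lin_indep f -> (forall j, M (f j)) -> (m <= n)%N.
Proof. by move=> [e [_ ->]] indf; exact: lin_indep_leq. Qed.

(** An independent family of maximal length in M spans M, since a vector outside its span would
    lengthen it. *)
Lemma has_dim_bounded M n : submod_closed [in M] ->
  (forall m (f : 'I_m -> H), lin_indep f -> (forall j, M (f j)) -> (m <= n)%N) ->
  exists2 k, (k <= n)%N & has_dim M k.
Proof.
move=> sM bM.
pose P k := `[< exists2 f : 'I_k -> H, lin_indep f & forall j, M (f j) >].
have P0 : exists k, P k.
  by exists 0%N; apply/asboolP; exists (fun=> 0) => [c _|] [].
have Pn k : P k -> (k <= n)%N by move=> /asboolP[f]; exact: bM.
case: (ex_maxnP P0 Pn) => k /asboolP[f indf Mf] kmax.
exists k; first exact: bM Mf.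
exists f; split => //; apply/seteqP; split=> [x Mx|_ [c _ <-]]; last first.
  exact: submod_lincomb.
apply: contrapT => xf; have := kmax k.+1; rewrite ltnn => /implyP.
rewrite implybF => /negP; apply; apply/asboolP.
exists (fun i => oapp f x (unlift ord0 i)); first exact: lin_indep_cons.
by move=> i; case: (unlift ord0 i).
Qed.

Lemma has_dim_subset_eq M N m n : has_dim M m -> has_dim N n ->
  M `<=` N -> (n <= m)%N -> M = N.
Proof.
move=> [f [indf Mf]] dN MN nm; apply/seteqP; split=> // x Nx.
rewrite Mf; apply: contrapT => xf.
have := has_dim_indep_leq dN (lin_indep_cons indf xf).
suff Nf j : N (oapp f x (unlift ord0 j)) by move=> /(_ Nf); rewrite ltnNge nm.
by case: (unlift ord0 j) => [i|//]; apply: MN; rewrite Mf; exact: lin_span_gen.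
Qed.

Lemma has_dim_add M N m n : has_dim M m -> has_dim N n ->
  exists k, has_dim [set x + y | x in M & y in N] k.
Proof.
move=> dM dN; have sM := has_dim_submod dM; have sN := has_dim_submod dN.
move: dM dN => [e [_ ME]] [e' [_ NE]].
(* The concatenated bases span the sum but need not be independent, so they only bound its
   dimension. *)
pose ee (i : 'I_(m + n)) :=
  match fintype.split i with inl j => e j | inr j => e' j end.
have eeM : M `<=` lin_span ee.
  rewrite ME => _ [c _ <-]; apply: (submod_lincomb (lin_span_submod ee)) => i.
  have -> : e i = ee (lshift n i) by rewrite /ee (unsplitK (inl i)).
  exact: lin_span_gen.
have eeN : N `<=` lin_span ee.
  rewrite NE => _ [c _ <-]; apply: (submod_lincomb (lin_span_submod ee)) => i.
  have -> : e' i = ee (rshift m i) by rewrite /ee (unsplitK (inr i)).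
  exact: lin_span_gen.
have [||k _ dk] := @has_dim_bounded [set x + y | x in M & y in N] (m + n).
- exact: submod_add.
- move=> k f indf MNf; apply: (lin_indep_leq indf) => j.
  have [x Mx [y Ny <-]] := MNf j.
  by apply: (submodD (lin_span_submod ee)); [exact: eeM|exact: eeN].
- by exists k.
Qed.

Lemma has_dim0 M : has_dim M 0%N <-> M = [set 0].
Proof.
split=> [[e [_ ->]]|->].
  apply/seteqP; split=> [_ [c _ <-]|_ ->]; first by rewrite big_ord0.
  by exists (fun=> 0); rewrite ?big_ord0.
exists (fun=> 0); split=> [c _ []//|].
apply/seteqP; split=> [_ ->|_ [c _ <-]]; last by rewrite big_ord0.
by exists (fun=> 0); rewrite ?big_ord0.
Qed.

(** The Gram matrix is invertible: a row in its left kernel yields a combination orthogonal to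
    itself. Coefficients are conjugated because [inner] is conjugate-linear in its first
    argument. *)
Lemma gram_solve n (e : 'I_n -> H) (c : 'I_n -> R[i]) : lin_indep e ->
  exists2 z, lin_span e z & forall i, inner z (e i) = c i.
Proof.
move=> inde; pose G := \matrix_(j, i) inner (e j) (e i) : 'M[R[i]]_n.
have comb (u : 'rV[R[i]]_n) i :
    inner (\sum_j (u 0 j)^* *: e j) (e i) = (u *m G) 0 i.
  rewrite inner_suml mxE; apply: eq_bigr => j _.
  by rewrite innerZl conjCK mxE.
have Gunit : G \in unitmx.
  rewrite -row_free_unit -kermx_eq0; apply/rowV0P => u /sub_kermxP uG0.
  have w0 : \sum_j (u 0 j)^* *: e j = 0.
    apply: inner_eq0; rewrite inner_sumr big1// => i _.
    by rewrite innerZr comb uG0 mxE mulr0.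
  apply/rowP => j; have := inde (fun j => (u 0 j)^*) w0 j.
  by rewrite mxE => /eqP; rewrite conjC_eq0 => /eqP.
exists (\sum_j (((\row_i c i) *m invmx G) 0 j)^* *: e j).
  by exists (fun j => (((\row_i c i) *m invmx G) 0 j)^*).
by move=> i; rewrite comb mulmxKV// mxE.
Qed.

(** Solving the Gram system gives the projection without presupposing that M is closed; closedness
    is then deduced from it. *)
Lemma has_dim_projection M n x : has_dim M n ->
  exists2 p, M p & orthocomplement M (x - p).
Proof.
move=> [e [inde ME]].
have [p ep pE] := gram_solve (fun i => inner x (e i)) inde.
exists p; first by rewrite ME.
move=> y; rewrite ME => -[c _ <-]; apply: inner_sym0.
rewrite inner_sumr big1// => i _.
by rewrite innerZr innerBl pE subrr mulr0.
Qed.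

Lemma has_dim_closed M n : has_dim M n -> closed M.
Proof.
move=> dM x clx; have [p Mp xp] := has_dim_projection x dM.
have xpM y : M y -> inner (x - p) y = 0 by move=> My; exact/inner_sym0/xp.
suff /inner_eq0/eqP : inner (x - p) (x - p) = 0 by rewrite subr_eq0 => /eqP->.
by rewrite innerBr (closure_ortho xpM clx) xpM// subrr.
Qed.

End FiniteDimension.

(** * Operators and selfadjoint subspaces *)

Section Operators.
Context {R : realType} {H : hilbertType R}.
Implicit Types (T B : set (H * H)) (M N : set H) (V : {linear H -> H}).

Lemma op_comb T a x y x' y' : submod_closed [in T] ->
  T (x, y) -> T (x', y') -> T (a *: x + x', a *: y + y').
Proof. by move=> sT; exact: (@submodP _ _ _ sT a (x, y) (x', y')). Qed.

Lemma op_add T x y x' y' : submod_closed [in T] ->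
  T (x, y) -> T (x', y') -> T (x + x', y + y').
Proof. by move=> sT; exact: (@submodD _ _ _ sT (x, y) (x', y')). Qed.

Lemma op_sub T x y x' y' : submod_closed [in T] ->
  T (x, y) -> T (x', y') -> T (x - x', y - y').
Proof. by move=> sT; exact: (@submodB _ _ _ sT (x, y) (x', y')). Qed.

Lemma op_lincomb T n (c : 'I_n -> R[i]) (f g : 'I_n -> H) :
  submod_closed [in T] -> (forall i, T (f i, g i)) ->
  T (\sum_i c i *: f i, \sum_i c i *: g i).
Proof.
move=> sT Tfg; elim/big_ind2 : _ => [|x y x' y'|i _].
- exact: (submod0 sT).
- exact: op_add.
- exact: (@submodZ _ _ _ sT (c i) (f i, g i)).
Qed.

Lemma dom_submod T : submod_closed [in T] -> submod_closed [in T.`1].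
Proof.
move=> sT; apply/submod_setP; split; first by exists 0; exact: (submod0 sT).
by move=> a x x' [y Ty] [y' Ty']; exists (a *: y + y'); exact: op_comb.
Qed.

Lemma restriction_submod T M : submod_closed [in T] -> submod_closed [in M] ->
  submod_closed [in restriction T M].
Proof.
move=> sT sM; apply/submod_setP; split.
  by split; [exact: (submod0 sT)|exact: (submod0 sM)].
move=> a p q [Tp Mp] [Tq Mq].
by split; [exact: (submodP sT)|exact: (submodP sM)].
Qed.

Lemma adjoint_in_submod T M : submod_closed [in M] ->
  submod_closed [in adjoint_in M T].
Proof.
move=> sM; apply/submod_setP; split.
  by split=> [||q _]; [exact: (submod0 sM) |exact: (submod0 sM)|rewrite /= !inner0l].
move=> a p q [Mp1 Mp2 Tp] [Mq1 Mq2 Tq].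
split=> [||r Tr] /=; first exact: (submodP sM).
  exact: (submodP sM).
by rewrite !innerDl !innerZl Tp// Tq.
Qed.

Lemma setT_submod : submod_closed [in [set: H]].
Proof. by apply/submod_setP. Qed.

Lemma Hsym_submod T : submod_closed [in T] -> submod_closed [in Hsym T].
Proof.
move=> sT; have sA := adjoint_in_submod T setT_submod; apply/submod_setP; split.
  by exists 0; split; [exact: (submod0 sT)|exact: (submod0 sA)].
move=> a x x' [y [Ty Ay]] [y' [Ty' Ay']]; exists (a *: y + y').
by split; exact: op_comb.
Qed.

Lemma adjoint_fun T x y z : densely_defined T ->
  adjoint T (x, y) -> adjoint T (x, z) -> y = z.
Proof.
move=> dT [_ _ xy] [_ _ xz]; apply/eqP; rewrite -subr_eq0; apply/eqP/inner_eq0.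
apply: (@closure_ortho _ _ T.`1).
  move=> u [v Tuv]; have := xy _ Tuv; rewrite (xz _ Tuv) /= innerBl => ->.
  by rewrite subrr.
move=> B; rewrite nbhsE => -[U [oU Ux] UB].
have [u [Uu Tu]] := dT U (ex_intro _ _ Ux) oU.
by exists u; split => //; exact: UB.
Qed.

Lemma kernel_submod V : submod_closed [in kernel_op V].
Proof.
apply/submod_setP; split; first exact: raddf0.
move=> a x y; rewrite /kernel_op /= => Vx Vy.
by rewrite linearP Vx Vy scaler0 addr0.
Qed.

(* Polarization: the forms at [x + y] and [x + 'i *: y] are real. *)
Lemma nonneg_op_sym V x y : nonneg_op V -> inner x (V y) = inner (V x) y.
Proof.
move=> V0; have Vr z : inner z (V z) = (inner z (V z))^*.
  by apply/esym/CrealP; rewrite ger0_real.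
pose a := inner x (V x); pose b := inner y (V y).
pose s := inner x (V y); pose t := inner y (V x).
have E1 : s + t = s^* + t^*.
  have E : a + s + (t + b) = a + s^* + (t^* + b).
    have := Vr (x + y); rewrite linearD !(innerDl, innerDr) -/a -/b -/s -/t.
    rewrite -[X in X = _]/(a + s + (t + b)) !rmorphD /=.
    by rewrite -(Vr x : a = _) -(Vr y : b = _).
  by transitivity (a + s + (t + b) - a - b); [|rewrite E]; ring.
have E2 : 'i * (s - t) = - 'i * (s^* - t^*).
  have E : a + 'i * s + (- 'i * t + b) = a - 'i * s^* + ('i * t^* + b).
    have := Vr (x + 'i *: y).
    rewrite linearD linearZ /= !(innerDl, innerDr, innerZl, innerZr) conjCi.
    rewrite -/a -/b -/s -/t.
    rewrite [- 'i * ('i * b)]mulrA [- 'i * 'i]mulNr -expr2 sqrCi opprK mul1r.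
    rewrite !(rmorphD, rmorphM, rmorphN) /= conjCi opprK [- 'i * s^*]mulNr.
    by rewrite -(Vr x : a = _) -(Vr y : b = _).
  by transitivity (a + 'i * s + (- 'i * t + b) - a - b); [|rewrite E]; ring.
have {}E2 : s - t = - (s^* - t^*).
  by apply: (mulfI (neq0Ci _)); rewrite E2 mulNr mulrN.
rewrite [RHS]innerC -/s -/t; apply: (mulfI (_ : 2 != 0)); first by rewrite pnatr_eq0.
transitivity (s + t + (s - t)); first by ring.
by rewrite E1 E2; ring.
Qed.

(** Symmetry of V makes its kernel the orthogonal complement of its range. *)
Lemma kernel_closed V : nonneg_op V -> closed (kernel_op V).
Proof.
move=> V0; rewrite (_ : kernel_op V = orthocomplement (range V)).
  exact: orthocomplement_closed.
apply/seteqP; split=> [x Vx _ [y _ <-]|x Vx].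
  by rewrite -nonneg_op_sym// Vx inner0r.
apply: inner_eq => y; rewrite inner0r nonneg_op_sym//.
by apply: Vx; exists y.
Qed.

(** A domain vector splits along M. Its component in the orthocomplement and the image of that
    component are orthogonal to M, so only selfadjointness inside M is tested. *)
Lemma selfadjoint_subspace_adjoint T M x y : is_operator T ->
  selfadjoint_subspace T M -> T (x, y) -> M x -> adjoint T (x, y).
Proof.
move=> [sT Tfun] [[sM cM [Tdec _] TM TMo] [_ _ TMsa]] Txy Mx.
have : restriction T M (x, y) by split.
rewrite TMsa => -[/= _ My adj].
split=> // -[u v] Tuv /=.
have : T.`1 u by exists v.
rewrite Tdec => -[a [[a' Taa'] Ma] [b [[b' Tbb'] Mb] abu]].
have -> : v = a' + b'.
  by apply: (Tfun u) => //; rewrite -abu; exact: op_add.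
rewrite -abu !innerDr (TMo _ _ Tbb' Mb)// (Mb y)// addr0 addr0.
by apply: (adj (a, a')).
Qed.

(** Lying inside the domain, P splits it by projection. Since T agrees with its adjoint on P,
    invariance of P passes to its orthocomplement. *)
Lemma selfadjoint_subspace_finite T P n : is_operator T -> has_dim P n ->
  P `<=` Hsym T -> (forall x y, T (x, y) -> P x -> P y) ->
  selfadjoint_subspace T P.
Proof.
move=> [sT Tfun] dP PH TP; have sP := has_dim_submod dP.
have Tadj x y : T (x, y) -> P x -> adjoint T (x, y).
  by move=> Txy /PH[z [Txz]]; rewrite (Tfun _ _ _ Txy Txz).
have PT : P `<=` T.`1 by move=> x /PH[y [Txy _]]; exists y.
split; split => //.
- exact: has_dim_closed dP.
- split.
    apply/seteqP; split=> [x Tx|_ [x [Tx _] [y [Ty _] <-]]]; last first.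
      exact: (submodD (dom_submod sT)).
    have [p Pp xp] := has_dim_projection x dP.
    exists p; first by split => //; exact: PT.
    exists (x - p); last by rewrite addrC subrK.
    by split => //; apply: (submodB (dom_submod sT)) => //; exact: PT.
  apply/seteqP; split=> [x [[_ Px] [_ Pox]]|_ ->].
    by apply: inner_eq0; exact: Pox.
  split; split; do ?exact: (submod0 (dom_submod sT)).
    exact: (submod0 sP).
  exact: (submod0 (orthocomplement_submod P)).
- move=> x y Txy Pox z Pz; have [w [Tzw Azw]] := PH _ Pz.
  have [_ _ /(_ _ Txy) /= ->] := Azw.
  by apply: Pox; exact: TP Tzw Pz.
- by move=> x [y []].
- move=> x Px; apply: subset_closure; have [y Txy] := PT _ Px.
  by exists y.
- apply/seteqP; split=> [[x y] [Txy Px]|[x y] [/= Px Py adj]].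
    split=> //=; first exact: TP Txy Px.
    by move=> q [Tq _]; have [_ _] := Tadj _ _ Txy Px; exact.
  have [z Txz] := PT _ Px; split => //=; rewrite (_ : y = z)//.
  have Pz := TP _ _ Txz Px.
  apply/eqP; rewrite -subr_eq0; apply/eqP/inner_eq0.
  have Pyz : P (y - z) by exact: submodB.
  have [u Tu] := PT _ Pyz.
  have [_ _ /(_ _ Tu) /= zu] := Tadj _ _ Txz Px.
  have := adj _ (conj Tu Pyz : restriction T P (_, _)); rewrite /= zu innerBl => ->.
  by rewrite subrr.
Qed.

End Operators.

(** * Selfadjoint subspaces of the dissipative extension *)

Section SymmetricPart.
Context {R : realType} {H : hilbertType R}.
Context (S : set (H * H)) (V : {linear H -> H}) (Ahat : set (H * H)).
Context (W : set H) (mu : nat).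
Hypothesis symS : symmetric_op S.
Hypothesis V_ge0 : nonneg_op V.
Hypothesis opA : is_operator Ahat.
Hypothesis SA : add_imag S V `<=` Ahat.
Hypothesis HsymE :
  is_direct_sum (Hsym Ahat) ((tildeS S Ahat).`1 `&` kernel_op V) W.
Hypothesis WV0 : W `&` kernel_op V = [set 0].
Hypothesis tildeS_ker :
  forall h k, tildeS S Ahat (h, k) -> kernel_op V h -> kernel_op V k.
Hypothesis cnsa : completely_nonselfadjoint (tildeS S Ahat).
Hypothesis dimW : has_dim W mu.

Let tS := tildeS S Ahat.

(** The image k is also the value at f of the adjoint of [hatS S Ahat], whose own graph contains (g,
    h). *)
Lemma tildeS_symmetric f k g h : tS (f, k) -> tS (g, h) -> inner f h = inner k g.
Proof.
move=> [/= Sfk [k' [[Sfk' _] Afk']]] [/= Sgh [h' [[Sgh' Ag] _]]].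
have [_ dS _] := symS; rewrite (adjoint_fun dS Sfk Sfk').
by have [_ _ adj] := Afk'; exact: (adj (g, h) (conj Sgh Ag)).
Qed.

Lemma tildeS_submod : submod_closed [in tS].
Proof.
have sS' : submod_closed [in adjoint S] := adjoint_in_submod S setT_submod.
apply: restriction_submod => //; apply: Hsym_submod; apply: restriction_submod => //.
exact/dom_submod/opA.1.
Qed.

Lemma Hsym_ker_tildeS f g : Ahat (f, g) -> adjoint Ahat (f, g) ->
  kernel_op V f -> tS (f, g) /\ kernel_op V g.
Proof.
move=> Afg A'fg Vf.
have : Hsym Ahat f by exists g.
rewrite HsymE.1 => -[l [[k tSlk] Vl] [w Ww lwf]].
(* V annihilates both f and its first summand, so w lies in W and in the kernel of V. *)
have w0 : w = 0.
  suff : (W `&` kernel_op V) w by rewrite WV0.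
  by split => //; move: Vf; rewrite -lwf /kernel_op /= linearD Vl add0r.
move: lwf; rewrite w0 addr0 => lf; rewrite lf in tSlk.
suff -> : g = k by split => //; exact: tildeS_ker tSlk Vf.
(* Both g and k are values of [adjoint S] at f: testing [adjoint Ahat] on S + iV amounts to testing
   on S because V f = 0. *)
have [_ dS _] := symS; have [Sfk _] := tSlk; apply: adjoint_fun dS _ Sfk.
split=> // -[p q] Spq /=; have [_ _ /= A'] := A'fg.
have /SA/A' : add_imag S V (p, q + 'i *: V p) by exists (p, q).
by rewrite /= innerDr innerZr nonneg_op_sym// Vf inner0l mulr0 addr0.
Qed.

(** Zero as component in W puts f in [Hsym Ahat]; uniqueness of the adjoint of S then identifies its
    image. *)
Lemma tildeS_ker_Hsym f k : tS (f, k) -> kernel_op V f ->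
  Ahat (f, k) /\ adjoint Ahat (f, k).
Proof.
move=> tSfk Vf.
have : Hsym Ahat f.
  rewrite HsymE.1; exists f; first by split => //; exists k.
  by exists 0; [exact: (submod0 (has_dim_submod dimW))|rewrite addr0].
move=> [g [Afg A'fg]]; have [[Sfg _] _] := Hsym_ker_tildeS Afg A'fg Vf.
have [_ dS _] := symS; have [Sfk _] := tSfk.
by rewrite (adjoint_fun dS Sfk Sfg).
Qed.

(** * The part of a selfadjoint subspace in the kernel of V *)

Section SelfadjointSubspace.
Context (M : set H).
Hypothesis saM : selfadjoint_subspace Ahat M.

Let TM := restriction Ahat M.
Let N := M `&` kernel_op V.

Let sA : submod_closed [in Ahat]. Proof. exact: opA.1. Qed.
Let sM : submod_closed [in M]. Proof. by case: saM => -[]. Qed.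
Let sN : submod_closed [in N]. Proof. exact/submodI/kernel_submod. Qed.
Let sTM : submod_closed [in TM]. Proof. exact: restriction_submod. Qed.

Let M_Hsym f g : Ahat (f, g) -> M f -> adjoint Ahat (f, g).
Proof. exact: selfadjoint_subspace_adjoint. Qed.

Let M_inv f g : Ahat (f, g) -> M f -> M g.
Proof. by case: saM => -[_ _ _ inv _] _; exact: inv. Qed.

(* Modulo [kernel_op V], vectors of [Hsym Ahat] agree with vectors of [W]. *)
Let indep_bound m (d : 'I_m -> H) : (forall i, TM.`1 (d i)) ->
  (forall c : 'I_m -> R[i], \sum_i c i *: V (d i) = 0 -> forall i, c i = 0) ->
  (m <= mu)%N.
Proof.
move=> TMd indVd.
have dec i : exists w, W w /\ V (d i) = V w.
  have [g [/= Adg Md]] := TMd i.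
  have : Hsym Ahat (d i) by exists g; split => //; exact: M_Hsym.
  rewrite HsymE.1 => -[l [_ Vl] [w Ww <-]].
  by exists w; rewrite linearD Vl add0r.
have [w wP] := choice dec.
apply: (has_dim_indep_leq dimW (f := w)) => [c cw0|i]; last by have [] := wP i.
apply: indVd; transitivity (V (\sum_i c i *: w i)); last by rewrite cw0 linear0.
rewrite linear_sum; apply: eq_bigr => i _.
by rewrite linearZ; have [_ ->] := wP i.
Qed.

(** The functional sending f to <x, g> - <y, f> vanishes where V f = 0, so it factors through V. The
    image [X] is finite-dimensional, and a Gram system on it represents the functional as <z, V f> =
    <V z, f>. *)
Let TM_representation x y :
  (forall f g, TM (f, g) -> V f = 0 -> inner x g = inner y f) ->
  exists z, forall f g, TM (f, g) -> inner x g = inner (y + V z) f.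
Proof.
move=> xy; pose X := [set V f | f in TM.`1].
have sX : submod_closed [in X].
  apply/submod_setP; split.
    by exists 0; [exact: (submod0 (dom_submod sTM))|exact: linear0].
  move=> a _ _ [f TMf <-] [g TMg <-]; exists (a *: f + g).
    exact: (submodP (dom_submod sTM)).
  by rewrite linearP.
have [m e inde Xe|k _ [e [inde XE]]] := has_dim_bounded (n := mu) sX.
  have /choice[d dP] i : exists f, TM.`1 f /\ V f = e i.
    by have [f TMf Vf] := Xe i; exists f.
  apply: (indep_bound (d := d)) => [i|c cVd]; first by have [] := dP i.
  apply: inde; rewrite -[RHS]cVd; apply: eq_bigr => i _.
  by have [_ ->] := dP i.
have /choice[p pP] i : exists p, TM p /\ V p.1 = e i.
  have : X (e i) by rewrite XE; exact: lin_span_gen.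
  by move=> [f [g TMfg] Vf]; exists (f, g).
have TMp i : TM ((p i).1, (p i).2) by have [] := pP i; case: (p i).
have [z _ zE] := gram_solve (fun i => inner x (p i).2 - inner y (p i).1) inde.
exists z => f g TMfg.
have : X (V f) by exists f => //; exists g.
rewrite XE => -[c _ cVf].
(* Subtracting preimages of the basis of [X] moves f into the kernel of V, where [xy] applies. *)
have TMc := op_sub sTM TMfg (op_lincomb c sTM TMp).
have /(xy _ _ TMc) : V (f - \sum_i c i *: (p i).1) = 0.
  rewrite linearB linear_sum -cVf -[LHS]sumrB big1// => i _.
  by rewrite linearZ; have [_ ->] := pP i; rewrite subrr.
rewrite !innerBr innerDl -nonneg_op_sym// -cVf !inner_sumr => E.
have -> : \sum_i inner z (c i *: e i) =
    \sum_i inner x (c i *: (p i).2) - \sum_i inner y (c i *: (p i).1).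
  by rewrite -sumrB; apply: eq_bigr => i _; rewrite !innerZr zE mulrBr.
by rewrite addrCA -E addrC subrK.
Qed.

Let TL f g : Ahat (f, g) -> N f -> tS (f, g) /\ N g.
Proof.
move=> Afg [Mf Vf]; have [tSfg Vg] := Hsym_ker_tildeS Afg (M_Hsym Afg Mf) Vf.
by split => //; split => //; exact: M_inv Afg Mf.
Qed.

Let restriction_tildeS : restriction tS N = restriction Ahat N.
Proof.
apply/seteqP; split=> -[f g] [/= fg [Mf Vf]]; split=> //=.
  exact: (tildeS_ker_Hsym fg Vf).1.
exact: (TL fg (conj Mf Vf)).1.
Qed.

(** A vector y orthogonal to the domain of the restriction becomes orthogonal to all of M after
    adding some V z, and this correction is invisible on the kernel of V. *)
Let restriction_N_dense : N `<=` closure (restriction Ahat N).`1.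
Proof.
move=> x [Mx Vx]; apply: closure_biortho => [|y yL].
  exact/dom_submod/restriction_submod.
have [f g TMfg Vf|z zE] := TM_representation (x := 0) (y := y).
  rewrite inner0l yL//; exists g; split=> /=; first by have [] := TMfg.
  by split => //; have [] := TMfg.
have : inner (y + V z) x = 0.
  have [_ [_ Mcl _]] := saM; apply: closure_ortho (Mcl _ Mx) => f [g TMfg].
  by rewrite -(zE _ _ TMfg) inner0l.
by rewrite innerDl -nonneg_op_sym// Vx inner0r addr0.
Qed.

Let restriction_N_adjoint : restriction Ahat N = adjoint_in N (restriction Ahat N).
Proof.
apply/seteqP; split=> [[x y] [/= Axy Nx]|[x y] [/= Nx Ny adj]].
  split=> //=; first exact: (TL Axy Nx).2.
  move=> [f g] [/= Afg Nf]; apply: tildeS_symmetric.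
    exact: (TL Axy Nx).1.
  exact: (TL Afg Nf).1.
have [f g [/= Afg Mf] Vf|z zE] := TM_representation (x := x) (y := y).
  exact: (adj (f, g) (conj Afg (conj Mf Vf))).
have [cM [_ _ TMsa]] : closed M /\ selfadjoint_in M TM.
  by case: saM => -[].
(* V z need not lie in M; its projection p has the same inner products with M and makes
   [adjoint_in M] applicable to y + p. *)
have [p Mp pV] := ortho_projection (V z) sM cM.
have zp f : M f -> inner (V z) f = inner p f.
  by move=> /pV/inner_sym0/eqP; rewrite innerBl subr_eq0 => /eqP.
have [Axyp _] : TM (x, y + p).
  rewrite TMsa; split=> /=; first by case: Nx.
    by apply: submodD => //; case: Ny.
  move=> [f g] TMfg /=; rewrite (zE _ _ TMfg) !innerDl zp//.
  by have [] := TMfg.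
(* The image y + p lies in N, hence so does p; orthogonal to a domain dense in N, it vanishes. *)
have [_ Nyp] := TL Axyp Nx.
have Np : N p by rewrite -[p](addKr y) addrC; exact: submodB.
suff p0 : p = 0 by split => //=; rewrite -[y]addr0 -p0.
apply: inner_eq0; apply: closure_ortho (restriction_N_dense Np) => f [g [/= Afg Nf]].
have := zE f g (conj Afg Nf.1).
rewrite (adj (f, g) (conj Afg Nf)) /= innerDl zp; last by case: Nf.
by move=> /eqP; rewrite -subr_eq0 opprD addrA subrr add0r oppr_eq0 => /eqP.
Qed.

Let N_closed : closed N.
Proof. by apply: closedI; [case: saM => -[]|exact: kernel_closed]. Qed.

Lemma selfadjoint_subspace_tildeS : selfadjoint_subspace tS (M `&` kernel_op V).
Proof.
have stS := tildeS_submod; have sdS := dom_submod stS.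
split; last first.
  split; rewrite -/N restriction_tildeS //.
  by move=> f [g []].
split=> //.
- split.
    apply/seteqP; split=> [f [k tSfk]|_ [f [Sf _] [g [Sg _] <-]]]; last first.
      exact: submodD.
    (* By symmetry of [tS], projecting f and its image k onto N gives a pair in the adjoint of the
       restriction; selfadjointness then puts p in the domain. *)
    have [p Np fp] := ortho_projection f sN N_closed.
    have [q Nq kq] := ortho_projection k sN N_closed.
    have [Apq _] : restriction Ahat N (p, q).
      rewrite restriction_N_adjoint; split=> //= -[l l'] [/= All' Nl].
      have [tSll' Nl'] := TL All' Nl.
      have /eqP := inner_sym0 (fp _ Nl'); rewrite innerBl subr_eq0 => /eqP <-.
      have /eqP := inner_sym0 (kq _ Nl); rewrite innerBl subr_eq0 => /eqP <-.
      exact: tildeS_symmetric.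
    have Sp : tS.`1 p by exists q; exact: (TL Apq Np).1.
    exists p => //; exists (f - p); last by rewrite addrC subrK.
    by split => //; apply: submodB => //; exists k.
  apply/seteqP; split=> [x [[_ Nx] [_ Nox]]|_ ->].
    by apply: inner_eq0; exact: Nox.
  split; split; do ?exact: submod0.
  exact: (submod0 (orthocomplement_submod _)).
- move=> x y tSxy [Mx Vx]; have [Axy _] := tildeS_ker_Hsym tSxy Vx.
  exact: (TL Axy (conj Mx Vx)).2.
- move=> x y tSxy Nox z Nz; apply: inner_sym0.
  (* Vectors of N are limits of domain vectors in N, and against those symmetry of [tS] applies. *)
  apply: closure_ortho (restriction_N_dense Nz) => f [g [/= Afg Nf]].
  have [tSfg Ng] := TL Afg Nf.
  by rewrite -(tildeS_symmetric tSxy tSfg) inner_sym0// Nox.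
Qed.

(** As [tS] is completely non-selfadjoint, V is injective on M, so the domain inside M has dimension
    at most mu. It is then closed, and being dense in M it is all of M. *)
Lemma selfadjoint_subspace_has_dim :
  M `<=` Ahat.`1 /\ exists2 k, (k <= mu)%N & has_dim M k.
Proof.
have N0 : M `&` kernel_op V = [set 0].
  have : [set N' | selfadjoint_subspace tS N'] (M `&` kernel_op V).
    exact: selfadjoint_subspace_tildeS.
  by rewrite cnsa.
have sD := dom_submod sTM.
have [m d indd TMd|k kmu dimD] := has_dim_bounded (n := mu) sD.
  apply: (indep_bound TMd) => c cVd; apply: indd.
  suff : (M `&` kernel_op V) (\sum_i c i *: d i) by rewrite N0.
  split.
    by apply: submod_lincomb => // i; have [g []] := TMd i.
  by rewrite /kernel_op /= -[RHS]cVd linear_sum; apply: eq_bigr => i _; rewrite linearZ.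
have MD : M `<=` TM.`1.
  have [_ [_ Mcl _]] := saM; move=> x Mx; apply: (has_dim_closed dimD); exact: Mcl.
split; first by move=> x /MD[y []]; exists y.
exists k => //; rewrite (_ : M = TM.`1)//; by apply/seteqP; split=> // x [y []].
Qed.

End SelfadjointSubspace.

(** * The largest selfadjoint subspace *)

Lemma largest_selfadjoint_subspace_ex :
  exists M, largest_selfadjoint_subspace Ahat M.
Proof.
have [sA Afun] := opA; have sH := Hsym_submod sA.
have sub_Hsym M : selfadjoint_subspace Ahat M -> M `<=` Hsym Ahat.
  move=> saM x Mx; have [/(_ _ Mx)[y Axy] _] := selfadjoint_subspace_has_dim saM.
  by exists y; split => //; exact: selfadjoint_subspace_adjoint saM Axy Mx.
pose P k := `[< exists2 M, selfadjoint_subspace Ahat M & has_dim M k >].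
have P0 : exists k, P k.
  have dim0 : has_dim [set (0 : H)] 0 by exact/has_dim0.
  exists 0%N; apply/asboolP; exists [set 0] => //.
  apply: (selfadjoint_subspace_finite opA dim0).
    by move=> _ ->; exact: (submod0 sH).
  by move=> x y Axy x0; move: Axy; rewrite x0 => /Afun; apply; exact: (submod0 sA).
have Pmu k : P k -> (k <= mu)%N.
  move=> /asboolP[M saM dM].
  have [_ [k' k'mu dM']] := selfadjoint_subspace_has_dim saM.
  apply: leq_trans k'mu; have [e [inde ME]] := dM.
  by apply: (has_dim_indep_leq dM' inde) => j; rewrite ME; exact: lin_span_gen.
case: (ex_maxnP P0 Pmu) => k /asboolP[M saM dM] kmax.
exists M; split => // N saN.
have [_ [n _ dN]] := selfadjoint_subspace_has_dim saN.
have sM := has_dim_submod dM; have sN := has_dim_submod dN.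
have [m dMN] := has_dim_add dM dN.
have saMN : selfadjoint_subspace Ahat [set x + y | x in M & y in N].
  apply: (selfadjoint_subspace_finite opA dMN).
    move=> _ [x Mx [y Ny <-]].
    by apply: (submodD sH); [exact: sub_Hsym Mx|exact: sub_Hsym Ny].
  move=> u z Auz [x Mx [y Ny xyu]].
  have [/(_ _ Mx)[x' Axx'] _] := selfadjoint_subspace_has_dim saM.
  have [/(_ _ Ny)[y' Ayy'] _] := selfadjoint_subspace_has_dim saN.
  have -> : z = x' + y'.
    by apply: (Afun u) => //; rewrite -xyu; exact: op_add.
  exists x'; first by have [[_ _ _ inv _] _] := saM; exact: inv Axx' Mx.
  by exists y' => //; have [[_ _ _ inv _] _] := saN; exact: inv Ayy' Ny.
(* Maximality bounds m by k, so M exhausts the sum and therefore contains N. *)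
have /kmax mk : P m by apply/asboolP; exists [set x + y | x in M & y in N].
rewrite (has_dim_subset_eq dM dMN _ mk).
  by move=> y Ny; exists 0; [exact: (submod0 sM)|exists y => //; rewrite add0r].
by move=> x Mx; exists x => //; exists 0; [exact: (submod0 sN)|rewrite addr0].
Qed.

Lemma Hsa_has_dim : exists2 n, (n <= mu)%N & has_dim (Hsa Ahat) n.
Proof.
(* Existence of a largest selfadjoint subspace rules out the default value [set0]. *)
have [saH _] := xgetPex set0 largest_selfadjoint_subspace_ex.
exact: (selfadjoint_subspace_has_dim saH).2.
Qed.

End SymmetricPart.

Theorem theorem4p17 (R : realType) (H : hilbertType R)
    (S : set (H * H)) (V : {linear H -> H}) (Ahat : set (H * H)) (W : set H) :
  symmetric_op S -> closed S ->
  (exists n, defect_indices S n n) ->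
  bounded_op V -> nonneg_op V ->
  maximally_dissipative Ahat -> add_imag S V `<=` Ahat ->
  is_subspace W -> W `<=` Hsym Ahat ->
  is_direct_sum (Hsym Ahat) ((tildeS S Ahat).`1 `&` kernel_op V) W ->
  W `&` (tildeS S Ahat).`1 = [set 0] -> W `&` kernel_op V = [set 0] ->
  (forall h k, tildeS S Ahat (h, k) -> kernel_op V h -> kernel_op V k) ->
  completely_nonselfadjoint (tildeS S Ahat) ->
  (W = [set 0] -> Hsa Ahat = [set 0]) /\
  (forall mu : nat, has_dim W mu ->
    exists2 n, (n <= mu)%N & has_dim (Hsa Ahat) n).
Proof.
move=> symS _ _ _ V_ge0 [[opA _ _] _] SA _ _ HsymE _ WV0 tS_ker cnsa.
have bound mu (dW : has_dim W mu) :=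
  Hsa_has_dim symS V_ge0 opA SA HsymE WV0 tS_ker cnsa dW.
(* A zero W has dimension 0, so (i) is the case mu = 0 of (ii). *)
split=> // /has_dim0/bound[n]; rewrite leqn0 => /eqP->.
by move/has_dim0.
Qed.
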